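(* Let $n$ and $m$ be positive integers. Then the characteristic polynomial of the Laplacian matrix $L(\mathcal{C}(n,m))$ is $$x(x-1)^{m-1}(x-(n+1))^{(m-1)(n-1)}(x-(m+1))\bigl(x^2-(m+n+1)x+mn\bigr)^{n-1}.$$
   Context: For positive integers $n,m$, $\mathcal{C}(n,m)$ is the graph with vertex set $\{u_j : j\in\mathbb{Z}_n\}\cup\{v_{t,j}: 1\le t\le m,\ j\in\mathbb{Z}_n\}$ whose edges are $v_{t,j}v_{t,j'}$ for all $t$ and all $j\ne j'$ (each set $\{v_{t,j}:j\in\mathbb{Z}_n\}$ induces $K_n$), and $u_jv_{t,j}$ for all $t,j$; there are no other edges. The Laplacian matrix is $L(G)=D(G)-A(G)$. *)

(* Defs.v *)
From mathcomp Require Import all_boot all_order all_algebra.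
Set Implicit Arguments.
Unset Strict Implicit.
Unset Printing Implicit Defensive.
Import GRing.Theory.
Local Open Scope ring_scope.

(* A finite simple graph is a symmetric irreflexive relation on a finType.
   Its matrices have rows and columns indexed through enum_val; another
   ordering of the vertices would give a conjugate by a permutation matrix. *)
Section GraphMatrices.
Variables (T : finType) (e : rel T).

Definition degree (x : T) : nat := #|[set y | e x y]|.

Definition adjacency_mx : 'M[int]_#|T| :=
  \matrix_(i, j) (e (enum_val i) (enum_val j))%:R.

Definition degree_mx : 'M[int]_#|T| :=
  diag_mx (\row_i (degree (enum_val i))%:R).

Definition laplacian_mx : 'M[int]_#|T| := degree_mx - adjacency_mx.

End GraphMatrices.

(* inl j stands for u_j and inr (t, j) for v_{t,j}. The ring structure of Z_n
   plays no role in the graph, so j ranges over the n-element type 'I_n;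
   the labels t are numbered from 0. *)
Definition C_vertex (n m : nat) : finType := ('I_n + 'I_m * 'I_n)%type.

Definition C_graph (n m : nat) : rel (C_vertex n m) := fun x y =>
  match x, y with
  | inl _, inl _ => false
  | inl i, inr (_, j) => i == j
  | inr (_, i), inl j => i == j
  | inr (s, i), inr (t, j) => (s == t) && (i != j)
  end.

Lemma C_graph_sym n m : symmetric (@C_graph n m).
Proof.
by case=> [i|[s i]] [j|[t j]] //=; rewrite eq_sym // [j == i]eq_sym.
Qed.

Lemma C_graph_irrefl n m : irreflexive (@C_graph n m).
Proof. by case=> [i|[s i]] //=; rewrite !eqxx. Qed.

(* Main.v *)
(* Ordering the vertices as (u, v), the matrix x - L is a 2 x 2 block matrix
   whose upper left block is the scalar a = x - m, so its determinant equals, up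
   to powers of a, that of the Schur-type complement
     a (x - n - 1) I + a (I (x) J_n) - J_m (x) I
   on the v vertices, J_k being the k x k all-ones matrix. A unimodular change
   of basis makes J_m and J_n triangular simultaneously in both tensor factors,
   and the determinant is read off the diagonal. *)
Require Import Defs.
From mathcomp Require Import all_boot all_order all_algebra.
From mathcomp Require Import perm ring mxtens.
Local Open Scope ring_scope.
Import GRing.Theory.

(** Two enumerations of [T] differ by a permutation acting on rows and columns alike, so its sign
    occurs twice and cancels. *)
Lemma det_reindex (R : comPzRingType) (T : finType) (N : nat) (f : 'I_N -> T)
    (F : T -> T -> R) : bijective f ->
  \det (\matrix_(i < #|T|, j < #|T|) F (enum_val i) (enum_val j)) =
  \det (\matrix_(i < N, j < N) F (f i) (f j)).
Proof.
move=> bij_f; have eN : N = #|T|.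
  by rewrite -(card_ord N); exact: bij_eq_card bij_f.
move: f bij_f; rewrite {}eN => f bij_f.
have inj_s : injective (enum_rank \o f).
  by apply: inj_comp (bij_inj bij_f); apply: enum_rank_inj.
pose s := perm inj_s.
set A := (X in \det X = _).
have -> : \matrix_(i < #|T|, j < #|T|) F (f i) (f j) = row_perm s (col_perm s A).
  by apply/matrixP=> i j; rewrite !mxE !permE /= !enum_rankK.
rewrite row_permE col_permE !det_mulmx !det_perm odd_permV mulrCA.
by rewrite -signr_addb addbb mulr1.
Qed.

(* Stated without inverses: it comes from multiplying on the right by the block
   matrix [[1, -B], [0, a]]. *)
Lemma det_block_scalar (R : comNzRingType) (p q : nat) (a : R)
    (B : 'M_(p, q)) (C : 'M_(q, p)) (D : 'M_q) :
  \det (block_mx a%:M B C D) * a ^+ q = a ^+ p * \det (a *: D - C *m B).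
Proof.
have := det_mulmx (block_mx a%:M B C D) (block_mx 1%:M (- B) 0 a%:M).
rewrite mulmx_block det_ublock det1 mul1r det_scalar => <-.
rewrite !mulmx1 !mulmx0 !addr0 mul_scalar_mx scalerN mul_mx_scalar addNr.
by rewrite det_lblock det_scalar mul_mx_scalar mulmxN addrC.
Qed.

(** Indices [i * n + j] are ordered lexicographically: above the diagonal either [i < i'], or
    [i = i'] and [j < j'], and one factor vanishes. *)
Lemma tensmx_trig (R : pzRingType) (m n : nat) (A : 'M[R]_m) (B : 'M[R]_n) :
  is_trig_mx A -> is_trig_mx B -> is_trig_mx (A *t B).
Proof.
move=> /is_trig_mxP tA /is_trig_mxP tB; apply/is_trig_mxP => k l.
case: (mxtens_indexP k) => i j; case: (mxtens_indexP l) => i' j' /= lt_kl.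
rewrite tensmxE; case: (ltngtP i i') => [/tA->|lt_i'i|eq_i].
- by rewrite mul0r.
- suff : (i' * n + j' <= i * n + j)%N by rewrite leqNgt lt_kl.
  apply: leq_trans (leq_addr _ _); apply: leq_trans (_ : i'.+1 * n <= _)%N.
    by rewrite mulSn addnC leq_add2r ltnW.
  by rewrite leq_mul2r lt_i'i orbT.
- by rewrite tB ?mulr0 //; move: lt_kl; rewrite eq_i ltn_add2l.
Qed.

Lemma tens1mx1 (R : pzRingType) (m n : nat) :
  (1%:M : 'M[R]_m) *t (1%:M : 'M[R]_n) = 1%:M.
Proof.
apply/matrixP=> k l.
case: (mxtens_indexP k) => i j; case: (mxtens_indexP l) => i' j'.
rewrite tensmxE !mxE -natrM mulnb (can_eq (@mxtens_indexK _ _)).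
by rewrite xpair_eqE.
Qed.

Section AllOnes.

Variables (R : comNzRingType).

(* The rows are (1, ..., 1), e_1, ..., e_n; in this basis the all-ones matrix
   becomes lower triangular. *)
Definition ones_basis (n : nat) : 'M[R]_n.+1 :=
  \matrix_(i, j) ((i == 0) || (i == j))%:R.

Definition ones_trig (n : nat) : 'M[R]_n.+1 :=
  \matrix_(i, j) (if j == 0 then if i == 0 then n.+1%:R else 1 else 0).

(** The all-ones matrix sends the row (1, ..., 1) to [n.+1] times itself and each other basis row to
    (1, ..., 1). *)
Lemma ones_basis_mul (n : nat) :
  ones_basis n *m const_mx 1 = ones_trig n *m ones_basis n.
Proof.
apply/matrixP=> i j; rewrite !mxE.
under eq_bigr do rewrite !mxE mulr1.
under [RHS]eq_bigr do rewrite !mxE.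
rewrite [RHS]big_ord_recl /= [X in _ = _ + X]big1 => [|k _]; last by rewrite mul0r.
rewrite addr0 mulr1; case: eqP => [->|/eqP ni0].
  by rewrite sumr_const card_ord.
by rewrite (bigD1 i) //= eqxx big1 ?addr0 // => k /negPf; rewrite eq_sym => ->.
Qed.

Lemma ones_trig_trig (n : nat) : is_trig_mx (ones_trig n).
Proof. by apply/is_trig_mxP => i [[|j] lt_j] //; rewrite mxE. Qed.

Lemma ones_basis_tr_trig (n : nat) : is_trig_mx (ones_basis n)^T.
Proof.
apply/is_trig_mxP => i j lt_ij; rewrite !mxE -[_ == 0]val_eqE -[j == i]val_eqE /=.
by rewrite (gtn_eqF lt_ij) (gtn_eqF (leq_ltn_trans (leq0n i) lt_ij)).
Qed.

Lemma det_tens_ones_basis (m n : nat) :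
  \det (ones_basis m *t ones_basis n) = 1.
Proof.
rewrite -det_tr trmx_tens det_trig; last first.
  by apply: tensmx_trig; apply: ones_basis_tr_trig.
apply: big1 => k _; case: (mxtens_indexP k) => i j.
by rewrite tensmxE !mxE !eqxx !orbT mulr1.
Qed.

Lemma det_tens_ones (m n : nat) (a b c : R) :
  \det (a%:M + b *: (1%:M *t const_mx 1 : 'M_(m.+1 * n.+1))
             + c *: (const_mx 1 *t 1%:M)) =
  (a + b * n.+1%:R + c * m.+1%:R) * (a + c * m.+1%:R) ^+ n
  * ((a + b * n.+1%:R) * a ^+ n) ^+ m.
Proof.
set W := (X in \det X).
pose P := ones_basis m *t ones_basis n.
pose U : 'M_(m.+1 * n.+1) :=
  a%:M + b *: (1%:M *t ones_trig n) + c *: (ones_trig m *t 1%:M).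
have PW : P *m W = U *m P.
  rewrite !(mulmxDl, mulmxDr) -!scalemxAl -!scalemxAr !tensmx_mul.
  by rewrite !mul1mx !mulmx1 !ones_basis_mul scalar_mxC.
(* As [\det P = 1], comparing determinants in [PW] suffices and no inverse of [P] is formed. *)
have -> : \det W = \det U.
  have := congr1 determinant PW.
  by rewrite !det_mulmx det_tens_ones_basis mul1r mulr1.
have UE k l : U k l = a *+ (k == l) + b * (1%:M *t ones_trig n) k l
    + c * (ones_trig m *t 1%:M) k l by rewrite !mxE.
have trigU : is_trig_mx U.
  have /is_trig_mxP t1 : is_trig_mx ((1%:M : 'M[R]_m.+1) *t ones_trig n).
    exact: tensmx_trig (scalar_mx_is_trig _ _) (ones_trig_trig n).
  have /is_trig_mxP t2 : is_trig_mx (ones_trig m *t (1%:M : 'M[R]_n.+1)).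
    exact: tensmx_trig (ones_trig_trig m) (scalar_mx_is_trig _ _).
  apply/is_trig_mxP => i j lt_ij.
  by rewrite UE t1 // t2 // !mulr0 -val_eqE (ltn_eqF lt_ij) !addr0.
rewrite det_trig //.
rewrite (reindex (@mxtens_index m.+1 n.+1)); last first.
  exists (@mxtens_unindex _ _) => k _; [exact: mxtens_indexK|].
  exact: mxtens_unindexK.
(* The diagonal of [U]: only index 0 of each factor carries an all-ones eigenvalue. The product then
   splits into the row [i = 0] and [m] equal rows. *)
pose d (i : 'I_m.+1) (j : 'I_n.+1) : R :=
  a + b * (if j == 0 then n.+1%:R else 0) + c * (if i == 0 then m.+1%:R else 0).
rewrite (eq_bigr (fun p => d p.1 p.2)) => [|[i j] _]; last first.
  rewrite UE !tensmxE !mxE !eqxx /d /=.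
  by case: (i == 0); case: (j == 0); rewrite ?mulr1 ?mul1r.
rewrite -(pair_bigA _ d) /d.
rewrite big_ord_recl /=; congr (_ * _).
  by rewrite big_ord_recl /= mulr0 addr0 prodr_const card_ord.
rewrite prodr_const card_ord; congr (_ ^+ _).
by rewrite big_ord_recl /= !mulr0 !addr0 prodr_const card_ord.
Qed.

End AllOnes.

Section CGraph.

Variables n m : nat.

Lemma degree_C_graph (x : C_vertex n m) :
  degree (@C_graph n m) x = if x is inl _ then m else n.
Proof.
rewrite /degree; case: x => [i|[s i]].
  pose f (t : 'I_m) : C_vertex n m := inr (t, i).
  rewrite (_ : [set y | _] = f @: setT).
    by rewrite card_imset ?cardsT ?card_ord // => t u [].
  apply/setP => -[j|[t j]]; rewrite inE /=.
    by apply/esym/imsetP => -[].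
  by apply/eqP/imsetP => [<-|[u _ [_ ->]]]; first by exists t.
(* The neighbours of [inr (s, i)] are listed by ['I_n]: the slot [j = i], which would be the vertex
   itself, is given to [inl i]. *)
pose f (j : 'I_n) : C_vertex n m := if j == i then inl i else inr (s, j).
have inj_f : injective f.
  rewrite /f => j k; do 2!case: eqP => [->|_] //.
  by case.
rewrite (_ : [set y | _] = f @: setT).
  by rewrite card_imset ?cardsT ?card_ord.
apply/setP => -[j|[t j]]; rewrite inE /=; apply/idP/imsetP.
- by move=> /eqP<-; exists i; rewrite // /f eqxx.
- by case=> k _; rewrite /f; case: eqP => // _ [->].
- case/andP=> /eqP<- ne_ij; exists j => //.
  by rewrite /f eq_sym (negPf ne_ij).
- by case=> k _; rewrite /f; case: eqP => // /eqP ne_ki [-> ->]; rewrite eqxx eq_sym.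
Qed.

(** The u vertices come first; the v vertices follow in Kronecker order, so that their block is a
    tensor expression. *)
Definition C_index (k : 'I_(n + m * n)) : C_vertex n m :=
  match split k with
  | inl i => inl i
  | inr l => inr (mxtens_unindex l)
  end.

Lemma C_index_bij : bijective C_index.
Proof.
pose g (x : C_vertex n m) : 'I_(n + m * n) := unsplit
  match x with inl i => inl i | inr p => inr (mxtens_index p) end.
exists g => [k|[i|p]]; rewrite /g /C_index.
- rewrite -[RHS]splitK; case: (split k) => //= l.
  by rewrite mxtens_unindexK.
- by rewrite unsplitK.
- by rewrite unsplitK mxtens_indexK.
Qed.

Lemma char_poly_C_graph_block :
  let B := \matrix_(i < n, k < m * n) (i == (mxtens_unindex k).2)%:R in
  char_poly (laplacian_mx (@C_graph n m)) =
  \det (block_mx ('X - m%:R%:P)%:M B B^T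
         (('X - n%:R%:P - 1)%:M + 1%:M *t const_mx 1)).
Proof.
move=> B; rewrite /char_poly.
(* Since x - L = (x - D) + A, adjacency enters with a plus sign. *)
pose F (x y : C_vertex n m) : {poly int} :=
  (x == y)%:R * ('X - (degree (@C_graph n m) x)%:R%:P) + (C_graph x y)%:R.
have -> : char_poly_mx (laplacian_mx (@C_graph n m)) =
          \matrix_(i, j) F (enum_val i) (enum_val j).
  apply/matrixP => i j; rewrite !mxE /F (inj_eq enum_val_inj).
  case: (i == j); rewrite ?mulr1n ?mulr0n ?mul1r ?mul0r;
    by case: C_graph; rewrite !(rmorphB, rmorph0, rmorph1); ring.
rewrite (det_reindex _ _ _ _ _ C_index_bij); congr (\det _).
apply/matrixP => k l; rewrite mxE -[k]splitK -[l]splitK.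
rewrite /F !degree_C_graph /C_index !unsplitK.
case: (split k) => [i|p]; case: (split l) => [j|q].
- by rewrite /= block_mxEul !mxE addr0 mulr_natl.
- by rewrite /= block_mxEur !mxE mul0r add0r.
- by rewrite /= block_mxEdl !mxE mul0r add0r eq_sym.
rewrite block_mxEdr.
case: (mxtens_indexP p) => s i; case: (mxtens_indexP q) => t j.
rewrite !mxtens_indexK mxE tensmxE !mxE (can_eq (@mxtens_indexK _ _)).
rewrite (inj_eq (@inr_inj _ _)) !xpair_eqE /=.
by case: (s == t); case: (i == j) => /=; rewrite ?mulr1n ?mulr0n; ring.
Qed.

End CGraph.

Theorem theorem5p1 (n m : nat) (hn : (0 < n)%N) (hm : (0 < m)%N) :
  char_poly (laplacian_mx (@C_graph n m)) =
    'X * ('X - 1%:P) ^+ (m - 1)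
       * ('X - (n%:R + 1)%:P) ^+ ((m - 1) * (n - 1))
       * ('X - (m%:R + 1)%:P)
       * ('X^2 - (m%:R + n%:R + 1) *: 'X + (m%:R * n%:R)%:P) ^+ (n - 1).
Proof.
case: n m hn hm => [|n] [|m] // _ _; rewrite !subn1 /=.
rewrite char_poly_C_graph_block.
set B := (X in block_mx _ X).
set a : {poly int} := 'X - m.+1%:R%:P.
have a0 : a != 0 by rewrite monic_neq0 // monicXsubC.
(* Multiplying by a nonzero power of [a] is harmless in the domain [{poly int}] and brings the goal
   to the form of [det_block_scalar]. *)
apply: (mulIf (expf_neq0 (m.+1 * n.+1) a0)).
rewrite det_block_scalar.
(* Two v vertices share a u neighbour exactly when their second indices agree, whatever their
   cliques. *)
have -> : B^T *m B = const_mx 1 *t 1%:M.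
  apply/matrixP => k l; case: (mxtens_indexP k) => s i.
  case: (mxtens_indexP l) => t j; rewrite tensmxE !mxE mul1r.
  rewrite (bigD1 i) //= big1 => [|x nx].
    by rewrite !mxE !mxtens_indexK eqxx mul1r addr0.
  by rewrite !mxE !mxtens_indexK (negPf nx) mul0r.
rewrite scalerDr scale_scalar_mx -[- (_ *t _)]scaleN1r det_tens_ones.
have cP k : (k%:R : int)%:P = k%:R :> {poly int} by rewrite rmorph_nat.
have -> : ('X - (n.+1%:R + 1)%:P : {poly int}) = 'X - n.+1%:R - 1.
  by rewrite polyCD cP; ring.
set q := 'X^2 - _ + _.
(* The sizes are now [n.+1] and [m.+1]. The diagonal values become [q], [a * ('X - 1)],
   ['X * ('X - (m.+1 + 1))] and [a * d]. *)
have -> : a * ('X - n.+1%:R%:P - 1) + -1 * m.+1%:R = q.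
  rewrite /q /a -mul_polyC !(polyCD, polyCM) !cP; ring.
set d := 'X - n.+1%:R - 1.
have -> : a * ('X - n.+1%:R%:P - 1) + a * n.+1%:R = a * ('X - 1%:P).
  by rewrite cP; ring.
have -> : a * ('X - 1%:P) + -1 * m.+1%:R = 'X * ('X - (m.+1%:R + 1)%:P).
  by rewrite /a polyCD !cP; ring.
(* The exponent of [a] on the right is [n.+1] from the u block plus [m * n.+1] from the rows
   [i != 0], matching [m.+1 * n.+1]. *)
rewrite cP -/d !exprMn -!exprM mulSn exprD (mulnS m n) exprD (mulnC n m).
by ring.
Qed.
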